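(* Let $E$ be an exact Courant algebroid over a smooth manifold $M$, let $G$ be a compact connected Lie group with Lie algebra $\mathfrak g$ acting on $M$, let $(\mathcal A,\chi)$ be an isotropic $G$-lifted action on $E$, and let $j:N\to M$ be (the inclusion of) a $G$-invariant submanifold on which $G$ acts freely, with quotient map $q:N\to M_{red}=N/G$. Let $L\subset E$ be an invariant Dirac structure. Fix an invariant isotropic splitting $\nabla$ of $E$ and a connection $\theta\in\Omega^1(N,\mathfrak g)$, and let $B\in\Omega^2(N)$, $\nabla_{red}$, $p_{red}^*$ and $L_{red}$ be the associated objects defined in the context. For $x\in N$ put $$\mathfrak{B}j(L_x)=\{X+dj_x^*\beta-i_XB\in T_xN\oplus T_x^*N \;|\; X\in T_xN,\ \beta\in T_x^*M,\ \nabla X+p^*\beta\in L_x\}.$$ Let $x\in N$, $Y\in T_{q(x)}M_{red}$ and $\eta\in T^*_{q(x)}M_{red}$. Then $$\nabla_{red}Y+p_{red}^*\eta\in L_{red}|_{q(x)}$$ if and only if there exists $X\in T_xN$ such that $Y=dq_x(X)$ and $X+dq_x^*\eta\in\mathfrak{B}j(L_x)$.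
   Context: Exact Courant algebroid: a vector bundle $E\to M$ with anchor $p:E\to TM$, a fibrewise nondegenerate symmetric bilinear form $\langle\cdot,\cdot\rangle$, and an $\mathbb R$-bilinear bracket $[\![\cdot,\cdot]\!]$ on $\Gamma(E)$ such that $[\![e_1,[\![e_2,e_3]\!]]\!]=[\![[\![e_1,e_2]\!],e_3]\!]+[\![e_2,[\![e_1,e_3]\!]]\!]$, $p[\![e_1,e_2]\!]=[p e_1,p e_2]$, $[\![e_1,fe_2]\!]=f[\![e_1,e_2]\!]+(\mathcal L_{p(e_1)}f)e_2$, $\mathcal L_{p(e_1)}\langle e_2,e_3\rangle=\langle[\![e_1,e_2]\!],e_3\rangle+\langle e_2,[\![e_1,e_3]\!]\rangle$, $[\![e,e]\!]=\frac12p^*d\langle e,e\rangle$, and $0\to T^*M\xrightarrow{p^*}E\xrightarrow{p}TM\to0$ is exact, where $\langle p^*\xi,e\rangle=\xi(p(e))$. An isotropic splitting is a bundle map $\nabla:TM\to E$ with $p\circ\nabla=\mathrm{id}$ and isotropic image. A Dirac structure is a Lagrangian subbundle $L\subset E$ ($L=L^\perp$) with $[\![\Gamma(L),\Gamma(L)]\!]\subset\Gamma(L)$. $\mathrm{Aut}(E)$ is the group of pairs $(\Psi,\psi)$, $\Psi:E\to E$ a bundle automorphism covering $\psi\in\mathrm{Diff}(M)$, preserving $\langle\cdot,\cdot\rangle$ and the bracket, with $p\circ\Psi=\psi_*\circ p$. Let $\psi_g$ be the diffeomorphism of $M$ given by $g\in G$. A $G$-lifted action is a pair $(\mathcal A,\chi)$,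 where $\mathcal A:G\to\mathrm{Aut}(E)$, $g\mapsto\mathcal A_g=(\Psi_g,\psi_g)$, is a homomorphism and $\chi:\mathfrak g\to\Gamma(E)$ is a bracket-preserving linear map such that the infinitesimal action of $u\in\mathfrak g$ on $\Gamma(E)$ induced by $\mathcal A$ equals $[\![\chi(u),\cdot]\!]$. It is isotropic if $\langle\chi(u),\chi(u)\rangle=0$ for all $u\in\mathfrak g$. Here $u\mapsto u_M=p(\chi(u))$ is the infinitesimal action of $\mathfrak g$ on $M$ (a Lie algebra homomorphism into vector fields), and $u_N=u_M|_N$. A subbundle is invariant if preserved by all $\Psi_g$; a splitting $\nabla$ is invariant if $\Psi_g\circ\nabla=\nabla\circ(\psi_g)_*$ for all $g$. For an invariant isotropic splitting $\nabla$, the moment one-form $\xi_\nabla:\mathfrak g\to\Omega^1(M)$ is defined by $\chi(u)=\nabla u_M+p^*\xi_\nabla(u)$. A connection $\theta\in\Omega^1(N,\mathfrak g)$ is a $G$-equivariant form with $\theta(u_N)=u$. The 2-form $B\in\Omega^2(N)$ is $$B(X,Y)=\langle\xi_\nabla(\theta(Y)),\theta(X)_N-X\rangle+\langle\xi_\nabla(\theta(X)),Y\rangle,\qquad X,Y\in T_xN,$$ where here $\langle\cdot,\cdot\rangle$ pairs covectors with vectors; it is $G$-invariant and satisfies $i_{u_N}B=j^*\xi_\nabla(u)$. For $x\in N$, $K_x=\{\chi(u)(x)\,|\,u\in\mathfrak g\}+p^*(\mathrm{Ann}(T_xN))\subset E_x$; $K$ is an invariant isotropic subbundle of $E|_N$.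 Set $E_{red}=(K^\perp/K)/G$, a bundle over $M_{red}$; for $k\in K_x^\perp$, $[k+K]\in E_{red}|_{q(x)}$ denotes the $G$-orbit of its class. The form on $E_{red}$ is $\langle[k_1+K],[k_2+K]\rangle_{red}=\langle k_1,k_2\rangle$. The map $p_{red}^*:T^*M_{red}\to E_{red}$ is $p_{red}^*\eta=[p^*\tilde\eta+K]$, where $\tilde\eta\in T_x^*M$ is any covector with $dj_x^*\tilde\eta=dq_x^*\eta$. The splitting $\nabla_{red}:TM_{red}\to E_{red}$ is $\nabla_{red}\,dq(X)=[\nabla X+p^*i_XB+K]$, $X\in TN$ (with $i_XB\in T^*N$ extended to a covector on $M$ in any way). Both are well defined. For an invariant Lagrangian $L$, fibrewise $$L_{red}=\left.\frac{L|_N\cap K^\perp+K}{K}\right/G\subset E_{red}$$ (a smooth Dirac structure when $L|_N\cap K$ has constant rank). *)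

(* Defs.v *)
From HB Require Import structures.
From mathcomp Require Import all_boot all_order all_algebra.
From mathcomp Require Import boolp classical_sets functions cardinality reals.
From mathcomp Require Import topology normedtype derive.

Set Implicit Arguments.
Unset Strict Implicit.
Unset Printing Implicit Defensive.
Import Order.TTheory GRing.Theory Num.Theory.
Import numFieldNormedType.Exports.
Local Open Scope classical_set_scope.
Local Open Scope ring_scope.

Fixpoint Ck (R : realType) (V W : normedModType R) (k : nat) (U : set V)
    (F : V -> W) : Prop :=
  if k is k'.+1 then
    (forall x, U x -> differentiable F x) /\
    (forall v, Ck k' U (fun x => 'd F x v))
  else forall x, U x -> {for x, continuous F}.

Definition Cinf (R : realType) (V W : normedModType R) (U : set V)
  (F : V -> W) := forall k, Ck k U F.

Record chart (R : realType) (T : topologicalType) (n : nat) := Chart {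
  cdom : set T;
  cmap :> T -> 'rV[R]_n;
  cinv : 'rV[R]_n -> T;
  cdom_open : open cdom;
  cimg_open : open (cmap @` cdom);
  cmapK : forall x, cdom x -> cinv (cmap x) = x;
  cmap_cont : forall x, cdom x -> {for x, continuous cmap};
  cinv_cont : forall z, (cmap @` cdom) z -> {for z, continuous cinv}
}.

(* The atlas is indexed by the points of the manifold: [chart_at x] is a chart
   around [x], which serves at the same time to identify T_xM with R^n (see
   [mdiff] below). Any atlas contains a smoothly equivalent one of this form. *)
Record manifold (R : realType) (n : nat) := Manifold {
  mcar :> topologicalType;
  chart_at : mcar -> chart R mcar n;
  mhausdorff : hausdorff_space mcar;
  msecond_countable : @second_countable mcar;
  chart_atP : forall x, cdom (chart_at x) x;
  chart_compat : forall x y,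
    Cinf (chart_at x @` (cdom (chart_at x) `&` cdom (chart_at y)))
         (chart_at y \o cinv (chart_at x))
}.
Arguments chart_at {R n m} x : rename.

Section Smooth.
Context {R : realType}.

Definition smooth_on n (M : manifold R n) (V : normedModType R)
    (U : set M) (F : M -> V) :=
  forall c : M, Cinf (chart_at c @` (cdom (chart_at c) `&` U))
                     (F \o cinv (chart_at c)).

Definition smooth_map m n (M : manifold R m) (N : manifold R n) (f : M -> N) :=
  continuous f /\
  forall c : N, smooth_on (f @^-1` cdom (chart_at c)) (chart_at c \o f).

(* Smoothness of functions of two variables, i.e. on the product manifold,
   in the product charts. *)
Definition smooth2_on m n (M : manifold R m) (N : manifold R n)
    (V : normedModType R) (U : set (M * N)) (F : M -> N -> V) :=
  forall (a : M) (b : N),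
    Cinf [set z : 'rV[R]_(m + n) |
            exists p : M * N, [/\ U p, cdom (chart_at a) p.1,
              cdom (chart_at b) p.2 &
              z = row_mx (chart_at a p.1) (chart_at b p.2)]]
         (fun z => F (cinv (chart_at a) (lsubmx z)) (cinv (chart_at b) (rsubmx z))).

Definition smooth2_map m n l (M : manifold R m) (N : manifold R n)
    (P : manifold R l) (f : M -> N -> P) :=
  continuous (fun p : M * N => f p.1 p.2) /\
  forall c : P, smooth2_on [set p | cdom (chart_at c) (f p.1 p.2)]
                           (fun x y => chart_at c (f x y)).

(* A tangent vector at [x] is given by its coordinates in the chart
   [chart_at x], so T_xM is ['rV[R]_n]; T_x^*M is the space ['cV[R]_n] of
   column vectors, paired with row vectors by the matrix product. *)

Definition mderiv n (M : manifold R n) (V : normedModType R) (F : M -> V)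
    (x : M) (v : 'rV[R]_n) : V :=
  'd (F \o cinv (chart_at x)) (chart_at x x) v.

Definition mdiff m n (M : manifold R m) (N : manifold R n) (f : M -> N)
    (x : M) (v : 'rV[R]_m) : 'rV[R]_n :=
  mderiv (chart_at (f x) \o f) x v.

Definition pairing n (xi : 'cV[R]_n) (v : 'rV[R]_n) : R := (v *m xi) 0 0.

Definition covec n (a : 'rV[R]_n -> R) : 'cV[R]_n :=
  \col_i a (delta_mx 0 i).

Definition mcodiff m n (M : manifold R m) (N : manifold R n) (f : M -> N)
    (x : M) (b : 'cV[R]_n) : 'cV[R]_m :=
  covec (fun v => pairing b (mdiff f x v)).

Definition dfun n (M : manifold R n) (f : M -> R) (x : M) : 'cV[R]_n :=
  covec (@mderiv n M R^o f x).

(* Coordinates of the vector field [X] in the chart at [c]. *)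
Definition vf_coord n (M : manifold R n) (c : M) (X : M -> 'rV[R]_n) (y : M) :
  'rV[R]_n := mderiv (chart_at c) y (X y).

Definition smooth_vf n (M : manifold R n) (X : M -> 'rV[R]_n) :=
  forall c : M, smooth_on (cdom (chart_at c)) (vf_coord c X).

(* [X,Y]^i = X^j d_j Y^i - Y^j d_j X^i, in the chart at [x]. *)
Definition vf_bracket n (M : manifold R n) (X Y : M -> 'rV[R]_n) (x : M) :
    'rV[R]_n :=
  mderiv (vf_coord x Y) x (X x) - mderiv (vf_coord x X) x (Y x).

Definition smooth_fun n (M : manifold R n) (f : M -> R) :=
  @smooth_on n M R^o setT f.

Definition smooth_embedding m n (N : manifold R n) (M : manifold R m)
    (j : N -> M) :=
  [/\ smooth_map j, injective j, forall x, injective (mdiff j x) &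
      forall U : set N, open U -> exists2 V : set M, open V & U = j @^-1` V].

(* [triv i] is a local trivialization over [tdom i], [frame i] its inverse. *)
Record vbundle m (M : manifold R m) (r : nat) := VBundle {
  fiber :> M -> vectType R;
  tindex : Type;
  tdom : tindex -> set M;
  triv : forall (i : tindex) (x : M), {linear fiber x -> 'rV[R]_r};
  frame : forall (i : tindex) (x : M), 'rV[R]_r -> fiber x;
  tdom_open : forall i, open (tdom i);
  tdom_cover : forall x, exists i, tdom i x;
  trivK : forall i x, tdom i x -> cancel (triv i x) (frame i x);
  frameK : forall i x, tdom i x -> cancel (frame i x) (triv i x);
  triv_compat : forall i i' w,
    smooth_on (tdom i `&` tdom i') (fun x => triv i' x (frame i x w))
}.

Definition section m (M : manifold R m) r (E : vbundle M r) :=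
  forall x : M, E x.

Definition smooth_section_on m (M : manifold R m) r (E : vbundle M r)
    (U : set M) (e : section E) :=
  forall i, smooth_on (U `&` tdom i) (fun x => triv i x (e x)).

Definition smooth_section m (M : manifold R m) r (E : vbundle M r)
    (e : section E) := smooth_section_on setT e.

Definition smooth_subbundle m (M : manifold R m) r (E : vbundle M r)
    (L : forall x, {vspace E x}) :=
  forall x : M, exists U : set M, exists s : nat, exists f : 'I_s -> section E,
    [/\ open U, U x, forall i, smooth_section_on U (f i) &
        forall y, U y -> basis_of (L y) [tuple f i y | i < s]].

Record lie_group (k : nat) := LieGroup {
  lg_man :> manifold R k;
  lg1 : lg_man;
  lgM : lg_man -> lg_man -> lg_man;
  lgV : lg_man -> lg_man;
  lgA : associative lgM;
  lg1l : left_id lg1 lgM;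
  lgVl : left_inverse lg1 lgV lgM;
  lgM_smooth : smooth2_map lgM;
  lgV_smooth : smooth_map lgV
}.

(* The Lie algebra of [G] is T_1G = 'rV[R]_k, with the bracket of the
   left-invariant vector fields. *)
Definition left_inv_vf k (G : lie_group k) (u : 'rV[R]_k) (g : G) : 'rV[R]_k :=
  mdiff (lgM g) (lg1 G) u.

Definition lie_bracket k (G : lie_group k) (u v : 'rV[R]_k) : 'rV[R]_k :=
  vf_bracket (@left_inv_vf k G u) (@left_inv_vf k G v) (lg1 G).

Definition Ad k (G : lie_group k) (g : G) : 'rV[R]_k -> 'rV[R]_k :=
  mdiff (fun h => lgM (lgM g h) (lgV g)) (lg1 G).

(* The vector field d/dt|_0 exp(-tu).x generated by u; with the sign, and the
   left-invariant bracket, u |-> inf_action a u is a Lie algebra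
   homomorphism. *)
Definition inf_action k (G : lie_group k) m (M : manifold R m)
    (a : G -> M -> M) (u : 'rV[R]_k) (x : M) : 'rV[R]_m :=
  - mdiff (fun g => a g x) (lg1 G) u.

Record courant m (M : manifold R m) (r : nat) := Courant {
  cbun :> vbundle M r;
  anchor : forall x : M, {linear cbun x -> 'rV[R]_m};
  cform : forall x : M, cbun x -> cbun x -> R;
  cbr : section cbun -> section cbun -> section cbun;
  (* p^* : T_x^*M -> E_x, determined by [costarP]. *)
  costar : forall x : M, {linear 'cV[R]_m -> cbun x};
  anchor_smooth : forall e, smooth_section e ->
    smooth_vf (fun x => anchor x (e x));
  cform_sym : forall x e1 e2, @cform x e1 e2 = cform e2 e1;
  cform_linear : forall x e a e1 e2,
    @cform x e (a *: e1 + e2) = a * cform e e1 + cform e e2;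
  cform_nondeg : forall x e, (forall e', @cform x e e' = 0) -> e = 0;
  cform_smooth : forall e1 e2, smooth_section e1 -> smooth_section e2 ->
    smooth_fun (fun x => cform (e1 x) (e2 x));
  cbr_smooth : forall e1 e2, smooth_section e1 -> smooth_section e2 ->
    smooth_section (cbr e1 e2);
  cbr_linearl : forall (a : R) e1 e2 e3, smooth_section e1 ->
    smooth_section e2 -> smooth_section e3 -> forall x,
    cbr (fun y => a *: e1 y + e2 y) e3 x = a *: cbr e1 e3 x + cbr e2 e3 x;
  cbr_linearr : forall (a : R) e1 e2 e3, smooth_section e1 ->
    smooth_section e2 -> smooth_section e3 -> forall x,
    cbr e1 (fun y => a *: e2 y + e3 y) x = a *: cbr e1 e2 x + cbr e1 e3 x;
  cbr_jacobi : forall e1 e2 e3, smooth_section e1 -> smooth_section e2 ->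
    smooth_section e3 -> forall x,
    cbr e1 (cbr e2 e3) x = cbr (cbr e1 e2) e3 x + cbr e2 (cbr e1 e3) x;
  cbr_anchor : forall e1 e2, smooth_section e1 -> smooth_section e2 ->
    forall x, anchor x (cbr e1 e2 x) =
      vf_bracket (fun y => anchor y (e1 y)) (fun y => anchor y (e2 y)) x;
  cbr_leibniz : forall f e1 e2, smooth_fun f -> smooth_section e1 ->
    smooth_section e2 -> forall x,
    cbr e1 (fun y => f y *: e2 y) x =
      f x *: cbr e1 e2 x + pairing (dfun f x) (anchor x (e1 x)) *: e2 x;
  cbr_invariant : forall e1 e2 e3, smooth_section e1 -> smooth_section e2 ->
    smooth_section e3 -> forall x,
    pairing (dfun (fun y => cform (e2 y) (e3 y)) x) (anchor x (e1 x)) =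
      cform (cbr e1 e2 x) (e3 x) + cform (e2 x) (cbr e1 e3 x);
  costarP : forall x xi e, cform (costar x xi) e = pairing xi (anchor x e);
  cbr_diag : forall e, smooth_section e -> forall x,
    cbr e e x = 2^-1 *: costar x (dfun (fun y => cform (e y) (e y)) x);
  costar_inj : forall x, injective (costar x);
  courant_exact : forall x e, anchor x e = 0 <-> exists xi, e = costar x xi;
  anchor_surj : forall x X, exists e, anchor x e = X
}.
Arguments costar {m M r c} x : rename.
Arguments anchor {m M r c} x : rename.

Section Courant.
Context {m : nat} {M : manifold R m} {r : nat} (E : courant M r).

Record isotropic_splitting := IsotropicSplitting {
  spl :> forall x : M, {linear 'rV[R]_m -> E x};
  spl_smooth : forall X, smooth_vf X ->
    smooth_section (E := E) (fun x => spl x (X x));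
  splK : forall x X, anchor x (spl x X) = X;
  spl_isotropic : forall x X Y, cform (spl x X) (spl x Y) = 0
}.

Definition orth x (A : set (E x)) : set (E x) :=
  [set e | forall a, A a -> cform e a = 0].

Record dirac := Dirac {
  dsub :> forall x : M, {vspace E x};
  dsub_smooth : smooth_subbundle dsub;
  dsub_lagrangian : forall x, [set e | e \in dsub x] = orth [set e | e \in dsub x];
  dsub_involutive : forall e1 e2 : section E,
    smooth_section e1 -> smooth_section e2 ->
    (forall x, e1 x \in dsub x) -> (forall x, e2 x \in dsub x) ->
    forall x, cbr e1 e2 x \in dsub x
}.

Record courant_aut := CourantAut {
  abase : M -> M;
  alift : forall x : M, {linear E x -> E (abase x)};
  abase_smooth : smooth_map abase;
  abase_diffeo : exists f : M -> M,
    [/\ smooth_map f, cancel abase f & cancel f abase];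
  alift_bij : forall x, bijective (alift x);
  alift_smooth : forall i i' w,
    smooth_on (tdom (v := E) i `&` abase @^-1` tdom (v := E) i')
              (fun x => triv i' (abase x) (alift x (frame i x w)));
  alift_form : forall x e1 e2, cform (alift x e1) (alift x e2) = cform e1 e2;
  alift_anchor : forall x e,
    anchor (abase x) (alift x e) = mdiff abase x (anchor x e);
  (* [e_i'] stands for the push-forward of the section [e_i]. *)
  alift_bracket : forall e1 e2 e1' e2' : section E,
    smooth_section e1 -> smooth_section e2 ->
    smooth_section e1' -> smooth_section e2' ->
    (forall x, e1' (abase x) = alift x (e1 x)) ->
    (forall x, e2' (abase x) = alift x (e2 x)) ->
    forall x, cbr e1' e2' (abase x) = alift x (cbr e1 e2 x)
}.

Definition etotal := {x : M & E x}.

Definition tot (x : M) (e : E x) : etotal := existT (fun y => E y : Type) x e.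

Definition act_total (a : courant_aut) (p : etotal) : etotal :=
  tot (alift a (projT1 p) (projT2 p)).

Record lifted_action k (G : lie_group k) := LiftedAction {
  lact : G -> courant_aut;
  lchi : 'rV[R]_k -> section E;
  lact1 : forall p, act_total (lact (lg1 G)) p = p;
  lactM : forall g h p,
    act_total (lact (lgM g h)) p = act_total (lact g) (act_total (lact h) p);
  lact_smooth : smooth2_map (fun g => abase (lact g));
  lact_lift_smooth : forall i i' w,
    smooth2_on [set p : G * M | tdom (v := E) i p.2 /\
                                tdom (v := E) i' (abase (lact p.1) p.2)]
      (fun g x => triv i' (abase (lact g) x) (alift (lact g) x (frame i x w)));
  lchi_smooth : forall u, smooth_section (lchi u);
  lchi_linear : forall a u v x, lchi (a *: u + v) x = a *: lchi u x + lchi v x;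
  lchi_bracket : forall u v x, lchi (lie_bracket G u v) x =
    cbr (lchi u) (lchi v) x;
  (* The infinitesimal action of u on e at x is d/dt|_0 Psi_g (e(g^-1 x)),
     g = exp(tu), a curve in E_x; it is read in a trivialization. *)
  lchi_action : forall u e, smooth_section e -> forall i x, tdom i x ->
    mderiv (fun g => triv i _
              (alift (lact g) _ (e (abase (lact (lgV g)) x)))) (lg1 G) u =
    triv i x (cbr (lchi u) e x);
  lchi_anchor : forall u x,
    anchor x (lchi u x) = inf_action (fun g => abase (lact g)) u x
}.

Section Lifted.
Context {k : nat} {G : lie_group k} (T : lifted_action G).

Definition lmap (g : G) : M -> M := abase (lact T g).

Definition isotropic_action :=
  forall u x, cform (lchi T u x) (lchi T u x) = 0.

Definition invariant_subbundle (L : forall x, {vspace E x}) :=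
  forall g x e, e \in L x -> alift (lact T g) x e \in L (lmap g x).

Definition invariant_splitting (nabla : isotropic_splitting) :=
  forall g x X,
    alift (lact T g) x (nabla x X) = nabla (lmap g x) (mdiff (lmap g) x X).

Definition moment_form (nabla : isotropic_splitting)
    (xi : 'rV[R]_k -> M -> 'cV[R]_m) :=
  forall u x, lchi T u x = nabla x (anchor x (lchi T u x)) + costar x (xi u x).

(* [j] embeds N as a G-invariant submanifold, with induced action [aN], on
   which G acts freely. *)
Record free_submanifold n (N : manifold R n) (j : N -> M) (aN : G -> N -> N)
  : Prop := FreeSubmanifold {
  sub_embedding : smooth_embedding j;
  sub_act_smooth : smooth2_map aN;
  sub_equivariant : forall g x, j (aN g x) = lmap g (j x);
  sub_free : forall g x, aN g x = x -> g = lg1 G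
}.

End Lifted.

(* [q : N -> P] is the quotient by the (free) action [aN]: the submersion
   whose fibers are the orbits, with dim P = dim N - dim G. *)
Record quotient_map k (G : lie_group k) n (N : manifold R n) d
    (P : manifold R d) (aN : G -> N -> N) (q : N -> P) : Prop := QuotientMap {
  quo_smooth : smooth_map q;
  quo_surj : forall y, exists x, q x = y;
  quo_submersion : forall x Y, exists X, mdiff q x X = Y;
  quo_orbit : forall x y, q x = q y <-> exists g, y = aN g x;
  quo_dim : (d + k = n)%N
}.

Record connection k (G : lie_group k) n (N : manifold R n)
    (aN : G -> N -> N) := Connection {
  conn :> forall x : N, {linear 'rV[R]_n -> 'rV[R]_k};
  conn_smooth : forall X, smooth_vf X -> smooth_on setT (fun x => conn x (X x));
  conn_equivariant : forall g x X,
    conn (aN g x) (mdiff (aN g) x X) = Ad g (conn x X);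
  conn_vertical : forall x u, conn x (inf_action aN u x) = u
}.

Section Reduction.
Context {k : nat} {G : lie_group k} (T : lifted_action G).
Context {n : nat} {N : manifold R n} (j : N -> M) (aN : G -> N -> N).
Context (nabla : isotropic_splitting) (xi : 'rV[R]_k -> M -> 'cV[R]_m).
Context (theta : connection aN).
Context {d : nat} {P : manifold R d} (q : N -> P).

(* B(X,Y); covectors on M are paired with vectors tangent to N through dj. *)
Definition redB (x : N) (X Y : 'rV[R]_n) : R :=
  pairing (xi (theta x Y) (j x))
          (mdiff j x (inf_action aN (theta x X) x - X)) +
  pairing (xi (theta x X) (j x)) (mdiff j x Y).

Definition iB (x : N) (X : 'rV[R]_n) : 'cV[R]_n := covec (redB x X).

Definition redK (x : N) : set (E (j x)) :=
  [set e | exists u z, (forall X, pairing z (mdiff j x X) = 0) /\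
                       e = lchi T u (j x) + costar (j x) z].

(* Elements of the fiber of E_red = (K^perp/K)/G are represented as subsets of
   the total space of E: [redcls x e] is the G-orbit of the coset e + K_x,
   i.e. the union of the cosets Psi_g(e + K_x). *)
Definition redcls (x : N) (e : E (j x)) : set etotal :=
  [set p | exists g a, @redK x a /\ p = act_total (lact T g) (tot (e + a))].

Definition redadd (A B : set etotal) : set etotal :=
  [set p | exists y (a b : E y), [/\ A (tot a), B (tot b) & p = tot (a + b)]].

(* The defining properties of p_red^* and nabla_red. Both maps are well
   defined, and determined by these equations. *)
Definition is_pred_star (pred : P -> 'cV[R]_d -> set etotal) :=
  forall x eta teta, mcodiff j x teta = mcodiff q x eta ->
    pred (q x) eta = redcls (costar (j x) teta).

Definition is_nabla_red (nred : P -> 'rV[R]_d -> set etotal) :=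
  forall x X b, mcodiff j x b = iB x X ->
    nred (q x) (mdiff q x X) =
    redcls (nabla (j x) (mdiff j x X) + costar (j x) b).

Definition redL (L : forall x, {vspace E x}) (y : P) : set (set etotal) :=
  [set A | exists x (l a : E (j x)), [/\ q x = y, l \in L (j x),
      orth (@redK x) l, @redK x a & A = redcls (l + a)]].

Definition pullB (L : forall x, {vspace E x}) (x : N) :
    set ('rV[R]_n * 'cV[R]_n) :=
  [set p | exists X b,
     nabla (j x) (mdiff j x X) + costar (j x) b \in L (j x) /\
     p = (X, mcodiff j x b - iB x X)].

End Reduction.
End Courant.
End Smooth.

(* Main.v *)
(* Write e(X, b) = nabla X + p^* b, so that <e(X,a), e(Y,b)> = a(Y) + b(X).
   Since p^* and nabla_red are only defined through representatives, the point
   is to choose these well. If e(X, b) is in L_x and j^* b = q^* eta + i_X B,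
   then e(X, b) differs from the representative of nabla_red Y + p_red^* eta
   built from X by an element of p^* Ann(T_xN), and it is orthogonal to K_x
   because <e(X,b), chi(u)> = xi(u)(X) + B(X,u_N) + eta(dq u_N) = 0.
   Conversely, an element of L_x in the class of nabla_red Y + p_red^* eta is
   e(X0, b0 + teta) + chi(u) + p^* z with z in Ann(T_xN); then X = X0 + u_N also
   projects to Y, and i_{u_N} B = j^* xi(u) gives the required covector. *)

Require Import Defs.
From HB Require Import structures.
From mathcomp Require Import all_boot all_order all_algebra.
From mathcomp Require Import boolp classical_sets functions cardinality reals.
From mathcomp Require Import topology normedtype landau derive.

Set Implicit Arguments.
Unset Strict Implicit.
Unset Printing Implicit Defensive.
Import Order.TTheory GRing.Theory Num.Theory.
Import numFieldNormedType.Exports.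
Local Open Scope classical_set_scope.
Local Open Scope ring_scope.

(** [f] and [g] share their first-order expansion at [x], whose linear part is unique. This serves
    to compare chart expressions that agree only near a point. *)
Lemma near_eq_diff (R : realType) (V W : normedModType R) (f g : V -> W)
    (x : V) :
  (\near x, f x = g x) -> differentiable f x ->
  differentiable g x /\ 'd g x = 'd f x :> (V -> W).
Proof.
move=> fg df.
have [dfc fE] : continuous ('d f x) /\
    f \o shift x = cst (f x) + 'd f x +o_ 0 id by apply/diff_locallyP.
have gE : g \o shift x = cst (g x) + 'd f x +o_ 0 id.
  rewrite -(nbhs_singleton fg); apply/eqaddoP => e e0.
  have : \forall h \near 0, f (h + x) = g (h + x).
    move: fg; rewrite (near_shift 0) /= => fg.
    by apply: filterS fg => h; rewrite /= subr0.
  move/eqaddoP : fE => /(_ e e0).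
  by apply: filterS2 => h /= + fgh; rewrite !fctE /= fgh.
have dgf := diff_unique dfc gE.
by split=> //; apply/diff_locallyP; rewrite dgf.
Qed.

(** * Derivatives in charts and the chain rule *)

Section ManifoldCalculus.
Context {R : realType}.

(** Continuity is a separate condition: [chart_at (f x)] takes arbitrary values outside its domain,
    so the chart expression alone does not control [f]. *)
Definition mdifferentiable m n (M : manifold R m) (N : manifold R n)
    (f : M -> N) (x : M) : Prop :=
  {for x, continuous f} /\
  differentiable (chart_at (f x) \o f \o cinv (chart_at x)) (chart_at x x).

Lemma chart_atK n (M : manifold R n) (x : M) :
  cinv (chart_at x) (chart_at x x) = x.
Proof. exact/cmapK/chart_atP. Qed.

Lemma cvg_cinv_chart n (M : manifold R n) (x : M) :
  cinv (chart_at x) z @[z --> chart_at x x] --> x.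
Proof.
rewrite -[X in _ --> X]chart_atK; apply: cinv_cont.
by exists x => //; exact: chart_atP.
Qed.

Lemma smooth_mdifferentiable m n (M : manifold R m) (N : manifold R n)
    (f : M -> N) (x : M) : smooth_map f -> mdifferentiable f x.
Proof.
move=> [cf sf]; split; first exact: cf.
have [/(_ (chart_at x x)) + _] := sf (f x) x 1; apply.
by exists x => //; split; exact: chart_atP.
Qed.

(** Freezing [y] composes the joint chart expression with the affine map [r], which inserts the
    constant block [chart_at y y]. *)
Lemma smooth2_mdifferentiable m n l (M : manifold R m) (N : manifold R n)
    (P : manifold R l) (f : M -> N -> P) (x : M) (y : N) :
  smooth2_map f -> mdifferentiable (fun x => f x y) x.
Proof.
move=> [cf sf]; split.
  apply: (@continuous_comp _ _ _ (fun z : M => (z, y))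
    (fun p : M * N => f p.1 p.2)).
    by apply: cvg_pair; [exact: cvg_id|exact: cvg_cst].
  exact: (cf (x, y)).
have [/(_ (row_mx (chart_at x x) (chart_at y y))) dF _] := sf (f x y) x y 1.
pose r : 'rV[R]_m -> 'rV[R]_(m + n) := fun z => row_mx z (chart_at y y).
have dr : differentiable r (chart_at x x).
  pose s : {linear 'rV[R]_m -> 'rV[R]_(m + n)} := mulmxr (row_mx 1%:M 0).
  have sE z : s z = row_mx z 0 by rewrite /s /= mul_mx_row mulmx1 mulmx0.
  have -> : r = (s : _ -> _) + cst (row_mx 0 (chart_at y y)).
    by apply/funext => z; rewrite fctE sE /r add_row_mx addr0 add0r.
  apply: differentiableD => //; apply: linear_differentiable.
  (* Continuity of [s]: each entry of [s v] is an entry of [v] or 0, so balls go into balls of the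
     same radius. *)
  move=> u A /nbhs_ballP[e /= e0 eA].
  apply/nbhs_ballP; exists e => //= v [_ uv]; apply: eA; split => // i i'.
  rewrite -[X in ball X]/(s u i i') !sE.
  case: (split_ordP i') => l' ->; rewrite ?row_mxEl ?row_mxEr //.
  by rewrite !mxE; exact: ballxx.
have -> : chart_at (f x y) \o f^~ y \o cinv (chart_at x) =
    (fun z => chart_at (f x y)
      (f (cinv (chart_at x) (lsubmx z)) (cinv (chart_at y) (rsubmx z)))) \o r.
  by apply/funext => z; rewrite /r /= row_mxKl row_mxKr chart_atK.
apply: differentiable_comp => //; apply: dF.
exists (x, y); split=> //; exact: chart_atP.
Qed.

Lemma mdiff_comp m n l (M : manifold R m) (N : manifold R n)
    (P : manifold R l) (f : M -> N) (h : N -> P) (x : M) v :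
  mdifferentiable f x -> mdifferentiable h (f x) ->
  mdiff (h \o f) x v = mdiff h (f x) (mdiff f x v).
Proof.
move=> [cf df] [ch dh].
pose F := chart_at (f x) \o f \o cinv (chart_at x).
pose H := chart_at (h (f x)) \o h \o cinv (chart_at (f x)).
have FE : F (chart_at x x) = chart_at (f x) (f x) by rewrite /F /= chart_atK.
have dH : differentiable H (F (chart_at x x)) by rewrite FE.
(* [cmapK] cancels the middle chart only inside its domain; continuity of [f] keeps nearby points
   there. *)
have near_dom : \forall z \near chart_at x x,
    (H \o F) z = (chart_at (h (f x)) \o (h \o f) \o cinv (chart_at x)) z.
  have : \forall y \near f x, cdom (chart_at (f x)) y.
    by apply: open_nbhs_nbhs; split; [exact: cdom_open|exact: chart_atP].
  move=> /cf nf.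
  have : \forall z \near chart_at x x,
    cdom (chart_at (f x)) (f (cinv (chart_at x) z)) by exact: cvg_cinv_chart nf.
  apply: filterS => z /= dz.
  by rewrite /H /F /= cmapK.
have dHF : differentiable (H \o F) (chart_at x x).
  exact: differentiable_comp.
have [_ E] := near_eq_diff near_dom dHF.
rewrite /mdiff /mderiv E (diff_comp df dH) -/F.
by rewrite FE.
Qed.

End ManifoldCalculus.

(** * Linear algebra of tangent vectors and covectors *)

Section Covectors.
Context {R : realType}.

(** ['d] is a linear map by construction, so [mdiff] is linear even where [f] is not
    differentiable. *)
HB.instance Definition _ m n (M : manifold R m) (N : manifold R n) (f : M -> N)
    (x : M) :=
  GRing.Linear.copy (mdiff f x)
    ('d (chart_at (f x) \o f \o cinv (chart_at x)) (chart_at x x)).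

Lemma mdiffD m n (M : manifold R m) (N : manifold R n) (f : M -> N) x v w :
  mdiff f x (v + w) = mdiff f x v + mdiff f x w.
Proof. exact: linearD. Qed.

Lemma mdiffN m n (M : manifold R m) (N : manifold R n) (f : M -> N) x v :
  mdiff f x (- v) = - mdiff f x v.
Proof. exact: linearN. Qed.

Fact pairing_is_linear n (xi : 'cV[R]_n) : linear (pairing xi : _ -> R^o).
Proof. by move=> a v w; rewrite /pairing mulmxDl -scalemxAl !mxE. Qed.

HB.instance Definition _ n (xi : 'cV[R]_n) :=
  GRing.isLinear.Build R 'rV[R]_n R^o _ (pairing xi) (pairing_is_linear xi).

Lemma pairingDl n (xi zeta : 'cV[R]_n) v :
  pairing (xi + zeta) v = pairing xi v + pairing zeta v.
Proof. by rewrite /pairing mulmxDr mxE. Qed.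

Lemma pairingNl n (xi : 'cV[R]_n) v : pairing (- xi) v = - pairing xi v.
Proof. by rewrite /pairing mulmxN mxE. Qed.

Lemma pairingZl n a (xi : 'cV[R]_n) v : pairing (a *: xi) v = a * pairing xi v.
Proof. by rewrite /pairing -scalemxAr mxE. Qed.

Lemma pairing_covec n (a : 'rV[R]_n -> R) v :
  linear (a : _ -> R^o) -> pairing (covec a) v = a v.
Proof.
move=> la.
pose a' : {linear 'rV[R]_n -> R^o} := HB.pack (a : 'rV[R]_n -> R^o)
  (GRing.isLinear.Build _ _ _ _ (a : 'rV[R]_n -> R^o) la).
rewrite -[a]/(a' : _ -> _) [in RHS](row_sum_delta v) linear_sum /pairing mxE.
by apply: eq_bigr => i _; rewrite linearZ mxE.
Qed.

Lemma pairing_inj n (xi zeta : 'cV[R]_n) :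
  (forall v, pairing xi v = pairing zeta v) -> xi = zeta.
Proof.
move=> E; apply/matrixP => i k; rewrite ord1.
by have := E (delta_mx 0 i); rewrite /pairing -!rowE !mxE.
Qed.

Lemma pairing_mcodiff m n (M : manifold R m) (N : manifold R n) (f : M -> N)
    x b v : pairing (mcodiff f x b) v = pairing b (mdiff f x v).
Proof.
rewrite pairing_covec // => a u w.
by rewrite linearP [LHS]linearP.
Qed.

(** The matrix of an injective differential is row-free, hence has the right inverse [pinvmx A]. For
    [j], this extends covectors from N to M. *)
Lemma mcodiff_surj m n (M : manifold R m) (N : manifold R n) (f : M -> N) x a :
  injective (mdiff f x) -> exists b, mcodiff f x b = a.
Proof.
move=> inj_df; pose A := lin1_mx (mdiff f x).
have freeA : row_free A.
  apply: inj_row_free => v; rewrite mul_rV_lin1 /= => dv0.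
  by apply: inj_df; rewrite dv0 linear0.
exists (pinvmx A *m a); apply: pairing_inj => v.
rewrite pairing_mcodiff /pairing -[mdiff f x v](mul_rV_lin1 (mdiff f x)).
by rewrite mulmxA -(mulmxA v) mulmxVp // mulmx1.
Qed.

End Covectors.

(** * Pointwise algebra of the Courant algebroid and the lifted action *)

Section CourantAlgebra.
Context {R : realType} {m : nat} {M : manifold R m} {r : nat} (E : courant M r).

Lemma cformDr x (e a b : E x) : cform e (a + b) = cform e a + cform e b.
Proof. by have := cform_linear e 1 a b; rewrite scale1r mul1r. Qed.

Lemma cformDl x (e a b : E x) : cform (a + b) e = cform a e + cform b e.
Proof. by rewrite cform_sym cformDr !(cform_sym e). Qed.

(** Isotropy of [nabla] and the vanishing of p p^* leave only the cross terms. *)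
Lemma cform_split (nabla : isotropic_splitting E) x X Y a b :
  cform (nabla x X + costar E x a) (nabla x Y + costar E x b) =
  pairing a Y + pairing b X.
Proof.
have anchor_costar c : anchor E x (costar E x c) = 0.
  by apply/courant_exact; exists c.
rewrite cformDl !cformDr spl_isotropic add0r [cform (nabla x X) _]cform_sym.
by rewrite !costarP !splK anchor_costar linear0 addr0 addrC.
Qed.

Lemma tot_inj x : injective (@tot _ _ _ _ E x).
Proof. move=> e e' ee'; exact: (eq_from_Tagged ee'). Qed.

Context {k : nat} {G : lie_group k} (T : lifted_action E G).

Lemma lmap1 y : lmap T (lg1 G) y = y.
Proof. by have /(congr1 (@projT1 _ _)) := lact1 T (tot (0 : E y)). Qed.

Lemma lmapM g h y : lmap T (lgM g h) y = lmap T g (lmap T h y).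
Proof. by have /(congr1 (@projT1 _ _)) := lactM T g h (tot (0 : E y)). Qed.

(* [alift] lands in the fiber over [abase (lact T g) y], which is only
   propositionally equal to [z]. *)
Lemma alift_cast g y z : lmap T g y = z ->
  exists Psi : {linear E y -> E z},
    (forall e, tot (Psi e) = act_total (lact T g) (tot e)) /\
    forall L : dirac E, invariant_subbundle T L ->
      forall e, e \in L y -> Psi e \in L z.
Proof.
case: _ /; exists (alift (lact T g) y); split=> // L hL e; exact: hL.
Qed.

Lemma lchiD u v x : lchi T (u + v) x = lchi T u x + lchi T v x.
Proof. by have := lchi_linear T 1 u v x; rewrite !scale1r. Qed.

Lemma lchi0 x : lchi T 0 x = 0.
Proof. by apply: (addrI (lchi T 0 x)); rewrite -lchiD !addr0. Qed.

Lemma lchiN u x : lchi T (- u) x = - lchi T u x.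
Proof. by apply/eqP; rewrite -addr_eq0 -lchiD addNr lchi0. Qed.

(** Polarization of [hT]. *)
Lemma lchi_isotropic (hT : isotropic_action T) u v x :
  cform (lchi T u x) (lchi T v x) = 0.
Proof.
have := hT (u + v) x; rewrite lchiD cformDl !cformDr !hT add0r addr0.
rewrite [X in _ + X]cform_sym -mulr2n => /eqP.
by rewrite mulrn_eq0 => /eqP.
Qed.

(** p^* is injective, and p^* xi(u) = chi(u) - nabla u_M is linear in u. *)
Lemma moment_linear (nabla : isotropic_splitting E) xi
    (hxi : moment_form T nabla xi) a u v x :
  xi (a *: u + v) x = a *: xi u x + xi v x.
Proof.
apply: (@costar_inj _ _ _ _ E x).
have xiE w :
    costar E x (xi w x) = lchi T w x - nabla x (anchor E x (lchi T w x)).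
  by rewrite {1}(hxi w x) addrAC subrr add0r.
rewrite linearP !xiE lchi_linear (linearP (anchor E x)) (linearP (nabla x)).
rewrite scalerBr opprD !addrA.
by congr (_ + _); rewrite addrAC.
Qed.

End CourantAlgebra.

(** * Orbits in N and vertical vectors *)

Section FreeSubmanifold.
Context {R : realType} {m : nat} {M : manifold R m} {r : nat} (E : courant M r).
Context {k : nat} {G : lie_group k} (T : lifted_action E G).
Context {n : nat} {N : manifold R n} (j : N -> M) (aN : G -> N -> N).
Context (hN : free_submanifold T j aN).

Lemma sub_inj : injective j.
Proof. by case: (sub_embedding hN). Qed.

Lemma sub_act1 x : aN (lg1 G) x = x.
Proof. by apply: sub_inj; rewrite (sub_equivariant hN) lmap1. Qed.

Lemma sub_actM g h x : aN (lgM g h) x = aN g (aN h x).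
Proof. by apply: sub_inj; rewrite !(sub_equivariant hN) lmapM. Qed.

(** The element h^-1 g stabilizes [x], so it is 1 by freeness. *)
Lemma lmap_sub_inj g h x : lmap T g (j x) = lmap T h (j x) -> g = h.
Proof.
rewrite -!(sub_equivariant hN) => /sub_inj gh.
have E1 : lgM (lgV h) g = lg1 G.
  by apply: (sub_free hN (x := x)); rewrite sub_actM gh -sub_actM lgVl sub_act1.
have cancel : lgM (lgV h) g = lgM (lgV h) h by rewrite E1 lgVl.
(* Left cancellation from the left group axioms: 1 is written as (h^-1)^-1 h^-1. *)
by rewrite -[g]lg1l -[h]lg1l -(lgVl (lgV h)) -!lgA cancel.
Qed.

(** Chain rule: by equivariance, [j] carries the orbit map of [x] to that of [j x]. *)
Lemma mdiff_inf_action u x :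
  mdiff j x (inf_action aN u x) = inf_action (lmap T) u (j x).
Proof.
rewrite /inf_action mdiffN; congr (- _).
have df := smooth2_mdifferentiable (lg1 G) x (sub_act_smooth hN).
have sj : smooth_map j by case: (sub_embedding hN).
have := mdiff_comp u df (smooth_mdifferentiable _ sj).
have -> : j \o (fun g => aN g x) = (fun g => lmap T g (j x)).
  by apply/funext => g /=; rewrite (sub_equivariant hN).
by rewrite sub_act1 => <-.
Qed.

(** Chain rule again: [q] is constant along the orbit map of [x]. *)
Lemma quotient_vertical d (P : manifold R d) (q : N -> P) u x :
  quotient_map aN q -> mdiff q x (inf_action aN u x) = 0.
Proof.
move=> hq; rewrite /inf_action mdiffN; apply/eqP; rewrite oppr_eq0; apply/eqP.
have df := smooth2_mdifferentiable (lg1 G) x (sub_act_smooth hN).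
have := mdiff_comp u df (smooth_mdifferentiable _ (quo_smooth hq)).
rewrite sub_act1 => <-.
have -> : (q \o (fun g => aN g x)) = cst (q x).
  by apply/funext => g /=; apply/esym/(quo_orbit hq); exists g.
rewrite /mdiff /mderiv (_ : _ \o _ = cst (chart_at (q x) (q x))) //.
by rewrite diff_cst.
Qed.

End FreeSubmanifold.

(** * Classes in E_red and contractions of B *)

Section Reduction.
Context {R : realType} {m : nat} {M : manifold R m} {r : nat} (E : courant M r).
Context {k : nat} {G : lie_group k} (T : lifted_action E G).
Context {n : nat} {N : manifold R n} (j : N -> M) (aN : G -> N -> N).
Context (hN : free_submanifold T j aN).

Local Notation K x := (@redK _ _ _ _ _ _ _ T _ _ j x).

Lemma redK0 x : K x 0.
Proof.
exists 0, 0; split=> [X|]; last by rewrite lchi0 linear0 addr0.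
by rewrite /pairing mulmx0 mxE.
Qed.

Lemma redKD x a b : K x a -> K x b -> K x (a + b).
Proof.
move=> [u [z [z0 ->]]] [v [w [w0 ->]]]; exists (u + v), (z + w); split=> [X|].
  by rewrite pairingDl z0 w0 addr0.
by rewrite lchiD linearD addrACA.
Qed.

Lemma redKN x a : K x a -> K x (- a).
Proof.
move=> [u [z [z0 ->]]]; exists (- u), (- z); split=> [X|].
  by rewrite pairingNl z0 oppr0.
by rewrite lchiN linearN opprD.
Qed.

(** By freeness a unique [g] takes [x] to [y], so the part of the class over [j y] is a single
    translated coset. *)
Lemma redcls_fiber g x y (e : E (j x)) (e' : E (j y)) : aN g x = y ->
  redcls T e (tot e') <->
  exists a, K x a /\ tot e' = act_total (lact T g) (tot (e + a)).
Proof.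
move=> gxy; split=> [[h [a [Ka e'E]]]|[a [Ka e'E]]]; last by exists g, a.
exists a; split=> //; suff -> : g = h by [].
have /(congr1 (@projT1 _ _)) /= hy := e'E.
by apply: (lmap_sub_inj hN (x := x)); rewrite -(sub_equivariant hN) gxy.
Qed.

Lemma redcls_self x (e e' : E (j x)) :
  redcls T e (tot e') <-> exists a, K x a /\ e' = e + a.
Proof.
split=> [/(redcls_fiber e e' (sub_act1 hN x)) [a [Ka]]|[a [Ka ->]]].
  by rewrite lact1 => /tot_inj ->; exists a.
by exists (lg1 G), a; rewrite lact1.
Qed.

(** By freeness, members of the two classes over a common point come from the same [g]; linearity of
    Psi_g does the rest. *)
Lemma redadd_redcls x (e1 e2 : E (j x)) :
  redadd (redcls T e1) (redcls T e2) = redcls T (e1 + e2).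
Proof.
apply/seteqP; split=> p /=.
  move=> [y [a [b [[g [a1 [K1 aE]]] [h [a2 [K2 bE]]] ->]]]].
  have /(congr1 (@projT1 _ _)) /= gy := aE.
  have /(congr1 (@projT1 _ _)) /= hy := bE.
  have gh : g = h by apply: (lmap_sub_inj hN (x := x)); rewrite /lmap -gy.
  rewrite -{h hy}gh in bE; exists g, (a1 + a2); split; first exact: redKD.
  move: a b aE bE; rewrite gy => a b /tot_inj -> /tot_inj -> /=.
  by rewrite -linearD addrACA.
move=> [g [a [Ka ->]]].
(* The whole K-part is given to the first summand. *)
exists (abase (lact T g) (j x)), (alift (lact T g) _ (e1 + a)),
  (alift (lact T g) _ e2); split.
- by exists g, a.
- by exists g, 0; rewrite addr0; split=> //; exact: redK0.
- by rewrite -linearD addrAC.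
Qed.

Context (hT : isotropic_action T).
Context (nabla : isotropic_splitting E) (xi : 'rV[R]_k -> M -> 'cV[R]_m).
Context (hxi : moment_form T nabla xi) (theta : connection aN).

Lemma lchi_split u x : lchi T u (j x) =
  nabla (j x) (mdiff j x (inf_action aN u x)) + costar E (j x) (xi u (j x)).
Proof. by rewrite {1}hxi lchi_anchor (mdiff_inf_action hN). Qed.

(** Expansion of <chi(u), chi(v)> = 0 by [cform_split]. *)
Lemma moment_skew u v x :
  pairing (xi u (j x)) (mdiff j x (inf_action aN v x)) =
  - pairing (xi v (j x)) (mdiff j x (inf_action aN u x)).
Proof.
apply/eqP; rewrite -addr_eq0 -(cform_split nabla (j x)) -!lchi_split.
by rewrite lchi_isotropic.
Qed.

Lemma redB_linearl x Y : linear (fun X => redB j xi theta x X Y : R^o).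
Proof.
move=> a X X'; rewrite /redB /= linearP (moment_linear hxi) pairingDl pairingZl.
have -> : inf_action aN (a *: theta x X + theta x X') x - (a *: X + X') =
    a *: (inf_action aN (theta x X) x - X) +
    (inf_action aN (theta x X') x - X').
  rewrite /inf_action linearP /= opprD scalerBr scalerN opprD !addrA.
  by congr (_ + _); rewrite addrAC.
rewrite linearP [pairing _ _]linearP /=.
rewrite scalerDr !addrA; congr (_ + _).
by rewrite addrAC.
Qed.

Lemma redBDl x X X' Y :
  redB j xi theta x (X + X') Y = redB j xi theta x X Y + redB j xi theta x X' Y.
Proof. by have := redB_linearl x Y 1 X X'; rewrite /= !scale1r. Qed.

(** [covec] records only values on basis vectors; this linearity makes [iB] represent [redB] on all
    vectors. *)
Lemma redB_linearr x X : linear (redB j xi theta x X : _ -> R^o).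
Proof.
move=> a Y Y'; rewrite /redB /= linearP (moment_linear hxi) pairingDl pairingZl.
rewrite linearP [X in _ + X]linearP /= scalerDr !addrA; congr (_ + _).
by rewrite addrAC.
Qed.

Lemma pairing_iB x X Y : pairing (iB j xi theta x X) Y = redB j xi theta x X Y.
Proof. exact/pairing_covec/redB_linearr. Qed.

(** This is i_{u_N} B = j^* xi(u): as theta(u_N) = u, the vector in the first term of B vanishes. *)
Lemma redB_verticall u x Y :
  redB j xi theta x (inf_action aN u x) Y = pairing (xi u (j x)) (mdiff j x Y).
Proof.
by rewrite /redB conn_vertical subrr linear0 [pairing _ 0]linear0 add0r.
Qed.

(** By [moment_skew], xi(u)(theta(X)_N) cancels xi(theta(X))(u_N). *)
Lemma redB_verticalr u x X :
  redB j xi theta x X (inf_action aN u x) =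
  - pairing (xi u (j x)) (mdiff j x X).
Proof.
rewrite /redB conn_vertical mdiffD mdiffN [pairing _ (_ - _)]linearB /=.
by rewrite moment_skew addrAC addNr add0r.
Qed.

End Reduction.

Theorem proposition2p14 (R : realType)
    (m : nat) (M : manifold R m) (r : nat) (E : courant M r)
    (k : nat) (G : lie_group k)
    (hGcompact : compact [set: G]) (hGconnected : connected [set: G])
    (T : lifted_action E G) (hT : isotropic_action T)
    (n : nat) (N : manifold R n) (j : N -> M) (aN : G -> N -> N)
    (hN : free_submanifold T j aN)
    (d : nat) (Mred : manifold R d) (q : N -> Mred) (hq : quotient_map aN q)
    (L : dirac E) (hL : invariant_subbundle T L)
    (nabla : isotropic_splitting E) (hnabla : invariant_splitting T nabla)
    (xi : 'rV[R]_k -> M -> 'cV[R]_m) (hxi : moment_form T nabla xi)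
    (theta : connection aN)
    (pred_star : Mred -> 'cV[R]_d -> set (etotal E))
    (hpred_star : is_pred_star T j q pred_star)
    (nabla_red : Mred -> 'rV[R]_d -> set (etotal E))
    (hnabla_red : is_nabla_red T j nabla xi theta q nabla_red)
    (x : N) (Y : 'rV[R]_d) (eta : 'cV[R]_d) :
  redL T j q L (q x) (redadd (nabla_red (q x) Y) (pred_star (q x) eta)) <->
  exists X : 'rV[R]_n, Y = mdiff q x X /\
    pullB j nabla xi theta L x (X, mcodiff q x eta).
Proof.
have inj_dj : injective (mdiff j x) by case: (sub_embedding hN).
have [teta tetaE] := mcodiff_surj (mcodiff q x eta) inj_dj.
(* Any lift [X] of [Y] gives one representative of the sum; each direction picks its own lift. *)
have sumE X b : mcodiff j x b = iB j xi theta x X -> Y = mdiff q x X ->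
    redadd (nabla_red (q x) Y) (pred_star (q x) eta) =
    redcls T (nabla (j x) (mdiff j x X) + costar E (j x) (b + teta)).
  move=> bE ->; rewrite (hnabla_red _ _ _ bE) (hpred_star _ _ _ tetaE).
  by rewrite (redadd_redcls hN) linearD addrA.
split.
- have [X0 X0E] := quo_submersion hq x Y.
  have [b0 b0E] := mcodiff_surj (iB j xi theta x X0) inj_dj.
  rewrite (sumE _ _ b0E (esym X0E)).
  set e := nabla (j x) (mdiff j x X0) + costar E (j x) (b0 + teta).
  (* The element [l] lies over another point [x'] of the orbit, so [Psi] moves it to the fiber over
     [j x]. *)
  move=> [x' [l [a [/(quo_orbit hq)[g xE] lL l_orth Ka clsE]]]].
  have gx : lmap T g (j x') = j x by rewrite xE (sub_equivariant hN).
  have [Psi [PsiE PsiL]] := alift_cast gx.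
  (* [Psi l] is the point of the class [redcls T (l + a)] given by [- a]; the
     equality of the two classes puts it in [e + K_x], so the invariance of
     [K] is not needed. *)
  have [c [[u [z [z0 ->]]] PsilE]] : exists c, redK T c /\ Psi l = e + c.
    apply/(redcls_self hN); rewrite clsE (redcls_fiber hN _ _ (esym xE)).
    by exists (- a); rewrite addrK; split=> //; exact: redKN.
  (* Splitting chi(u) as nabla u_N + p^* xi(u) gives [Psi l] this tangent part and the covector
     chosen below. *)
  exists (X0 + inf_action aN u x); split.
    by rewrite mdiffD (quotient_vertical hN) // addr0.
  exists (X0 + inf_action aN u x), (b0 + teta + (xi u (j x) + z)); split.
    suff -> : nabla (j x) (mdiff j x (X0 + inf_action aN u x)) +
        costar E (j x) (b0 + teta + (xi u (j x) + z)) = Psi l by exact: PsiL.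
    rewrite PsilE /e (lchi_split hN hxi) mdiffD.
    rewrite (linearD (nabla (j x))) !(linearD (costar E (j x))) -!addrA.
    congr (_ + _); rewrite addrCA; congr (_ + _).
    by rewrite addrCA.
  (* On TN, [z] vanishes, xi(u) cancels i_{u_N} B and [b0] cancels i_{X0} B; only [teta] remains. *)
  congr pair; apply: pairing_inj => Z.
  rewrite pairingDl pairingNl (pairing_mcodiff j) !pairingDl z0 addr0.
  rewrite -!(pairing_mcodiff j) b0E tetaE !(pairing_iB j hxi) (redBDl j hxi).
  rewrite redB_verticall (pairing_mcodiff j) opprD addrACA subrr addr0.
  by rewrite addrAC subrr add0r.
- move=> [X [YE [X' [b [bL [XE bE]]]]]]; rewrite -{X'}XE in bL bE.
  have [b0 b0E] := mcodiff_surj (iB j xi theta x X) inj_dj.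
  rewrite (sumE _ _ b0E YE).
  (* The K-correction turns the element of L into the representative from [sumE]. *)
  exists x, (nabla (j x) (mdiff j x X) + costar E (j x) b),
    (costar E (j x) (b0 + teta - b)); split=> //.
  + move=> _ [u [z [z0 ->]]].
    rewrite (lchi_split hN hxi) -addrA -linearD cform_split pairingDl z0 addr0.
    (* Evaluating [bE] on u_N, which dq kills, gives orthogonality to chi(u). *)
    have := congr1 (fun c => pairing c (inf_action aN u x)) bE.
    rewrite pairingDl pairingNl !pairing_mcodiff (quotient_vertical hN) //.
    rewrite (pairing_iB j hxi) (redB_verticalr hN hT hxi) opprK.
    by rewrite [pairing eta 0]linear0 => <-.
  + exists 0, (b0 + teta - b); split; last by rewrite lchi0 add0r.
    move=> Z; rewrite !pairingDl pairingNl -!(pairing_mcodiff j) b0E tetaE bE.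
    by rewrite pairingDl pairingNl addrCA subrr addr0 subrr.
  + by rewrite -addrA -linearD [b + _]addrC subrK.
Qed.
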